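(* Let $k\ge 2$, let $d>k-1$, and let $X=(x_1,\dots,x_n)^T\in\mathbb{R}^{n\times d}$ be a data set of $n$ observations coming from a mixture of $k$ Gaussian distributions on $\mathbb{R}^d$ with equal mixing factors $1/k$ (the covariance matrices may differ between components). Each component corresponds to one cluster, and the clusters are balanced, of size $n/k$ each. Assume that the number of observations is large with respect to the dimension, $n\gg d$, and that the empirical covariance matrix of $X$ has full rank $d$. Let $Y\in\mathbb{R}^{n\times d}$, with rows $y_1^T,\dots,y_n^T$, be the isotropic transformation of $X$. Let $\alpha>0$ be the weighting parameter and let $Z\in\mathbb{R}^{n\times d}$ be the weighted data with rows $\omega_i y_i^T$, where $$\omega_i=\sqrt{\frac{1}{1+\frac1\alpha\|y_i\|^2}},\qquad i=1,\dots,n,$$ with the same cluster assignment as $X$. Assume moreover that (i) terms of order $o(\|y_i\|^2)$ are negligible, so that one works in the linearized small-perturbation regime described in the context (weights replaced by their linear approximation, and scatter matrices and eigenvalues computed to first order in the perturbation); (ii) the standard deviation of the squared norms satisfies $$\operatorname{sd}(\|y_i\|^2):=\sqrt{\frac1n\sum_{i=1}^n\Big(\|y_i\|^2-\frac1n\sum_{m=1}^n\|y_m\|^2\Big)^2}<\frac dn .$$ Let $\overline{\lambda^X}$ and $\overline{\lambda^Z}$ denote the structure distinctness coefficients of $X$ and $Z$. Then, with the higher-order terms neglected as in (i), $$\left|\overline{\lambda^Z}-\overline{\lambda^X}\right|\le\frac{1}{\sqrt n}\left(\frac d\alpha\left(\overline{\lambda^X}+\sqrt k\right)\right).$$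
   Context: All quantities are empirical, i.e. computed from the given data matrix and the given cluster assignment. $\|\cdot\|$ is the Euclidean norm. For a data matrix $W\in\mathbb{R}^{n\times d}$ with rows $w_1^T,\dots,w_n^T$ and a partition of $\{1,\dots,n\}$ into $k$ clusters of sizes $n_1,\dots,n_k$, let $\mu_W=\frac1n\sum_i w_i$ be the grand mean and $\mu_{W,l}$ the mean of the observations in cluster $l$. Total scatter matrix: $T_W=\sum_{i=1}^n(w_i-\mu_W)(w_i-\mu_W)^T$ (that is, $n$ times the empirical covariance matrix). Between-cluster scatter matrix: $B_W=\sum_{l=1}^k n_l(\mu_{W,l}-\mu_W)(\mu_{W,l}-\mu_W)^T$. Structure distinctness coefficient (when $T_W$ is invertible): $\overline{\lambda^W}=\frac{1}{k-1}\sum_{j=1}^{k-1}\lambda^W_j$, where $\lambda^W_1\ge\dots\ge\lambda^W_d$ are the eigenvalues, counted with multiplicity, of $T_W^{-1}B_W$ (they are real and lie in $[0,1]$, and at most $k-1$ of them are nonzero). Isotropic transformation: let $X_0$ be the centered data with rows $(x_i-\mu_X)^T$, so $T_X=X_0^TX_0$, and let $T_X=ALA^T$ be a spectral decomposition with $A$ orthogonal and $L$ diagonal with positive entries. Then $Y=X_0AL^{-1/2}$. It satisfies $\mu_Y=0$ and $T_Y=Y^TY=\mathbf{I}$, and the average of $\|y_i\|^2$ over $i$ is $d/n\ll 1$. Linearized regime: put $\Delta=\frac{1}{2\alpha}\operatorname{diag}(\|y_1\|^2,\dots,\|y_n\|^2)$, let $E\in\{0,1\}^{n\times k}$ be the cluster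 membership matrix and $H=E(E^TE)^{-1}E^T$. Neglecting $o(\|y_i\|^2)$ means taking $\operatorname{diag}(\omega_1,\dots,\omega_n)\approx\mathbf{I}-\Delta$ and, dropping terms of higher order in $\Delta$, $T_Z\approx T_Y+\delta T_Y$ with $\delta T_Y=-2Y^T\Delta Y$, and $B_Z\approx B_Y+\delta B_Y$ with $\delta B_Y=-Y^TH\Delta Y-Y^T\Delta HY$. These perturbations are regarded as small ($\delta T_Y\ll T_Y$, $\delta B_Y\ll B_Y$), and the eigenvalues of the perturbed generalized eigenproblem are taken to first order: $\lambda^Z_j\approx\lambda^Y_j+a_j^T(\delta B_Y-\lambda^Y_j\,\delta T_Y)a_j$, where $a_j$ is the unit eigenvector with $B_Ya_j=\lambda^Y_ja_j$. *)

(* Defs.v *)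
From HB Require Import structures.
From mathcomp Require Import all_boot all_order all_algebra.
From mathcomp Require Import all_classical all_reals all_analysis.
From mathcomp Require Import polyrcf.
From mathcomp Require Import ring lra.
Import Order.TTheory GRing.Theory Num.Theory.
Import numFieldNormedType.Exports.

Set Implicit Arguments.
Unset Strict Implicit.
Unset Printing Implicit Defensive.

Local Open Scope classical_set_scope.
Local Open Scope ring_scope.

(* Observations are the rows of a data matrix; means are row vectors.  The
   library norm on matrices is the sup norm, hence [enorm]. *)

Section EuclideanNorm.
Context {R : realType}.

Definition enorm {d} (v : 'rV[R]_d) : R := Num.sqrt (\sum_j v 0 j ^+ 2).

End EuclideanNorm.

Section Empirical.
Context {R : realType}.

Definition emp_mean {n} (f : 'I_n -> R) : R := n%:R^-1 * \sum_i f i.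

Definition emp_sd {n} (f : 'I_n -> R) : R :=
  Num.sqrt (emp_mean (fun i => (f i - emp_mean f) ^+ 2)).

End Empirical.

Section Scatter.
Context {R : realType}.
Implicit Types n d k : nat.

Definition grand_mean {n d} (W : 'M[R]_(n, d)) : 'rV[R]_d :=
  n%:R^-1 *: \sum_i row i W.

Definition cluster_of {n k} (c : 'I_n -> 'I_k) (l : 'I_k) : {set 'I_n} :=
  [set i | c i == l]%SET.

Definition cluster_mean {n d k} (W : 'M[R]_(n, d)) (c : 'I_n -> 'I_k)
    (l : 'I_k) : 'rV[R]_d :=
  #|cluster_of c l|%:R^-1 *: \sum_(i in cluster_of c l) row i W.

Definition total_scatter {n d} (W : 'M[R]_(n, d)) : 'M[R]_d :=
  \sum_i (row i W - grand_mean W)^T *m (row i W - grand_mean W).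

Definition emp_cov {n d} (W : 'M[R]_(n, d)) : 'M[R]_d :=
  n%:R^-1 *: total_scatter W.

Definition between_scatter {n d k} (W : 'M[R]_(n, d)) (c : 'I_n -> 'I_k) :
    'M[R]_d :=
  \sum_l #|cluster_of c l|%:R *:
    ((cluster_mean W c l - grand_mean W)^T *m
     (cluster_mean W c l - grand_mean W)).

(* Real eigenvalues in decreasing order, repeated according to their algebraic
   multiplicity.  The matrices it is applied to have only real eigenvalues. *)
Definition eigenvalues {d} (M : 'M[R]_d) : seq R :=
  sort >=%R
    (flatten [seq nseq (mup x (char_poly M)) x | x <- rootsR (char_poly M)]).

Lemma eigenvaluesE d (M : 'M[R]_d) (s : seq R) :
  char_poly M = \prod_(x <- s) ('X - x%:P) -> eigenvalues M = sort >=%R s.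
Proof.
move=> Ms; have M0 : char_poly M != 0 by rewrite monic_neq0// char_poly_monic.
apply/perm_sortP.
- by move=> x y; exact: le_total.
- by move=> x y z /= yx zy; exact: le_trans zy yx.
- by move=> x y /andP[yx xy]; apply/le_anti/andP.
apply/allP => y _; apply/eqP; rewrite count_flatten -map_comp.
rewrite sumnE big_map.
under eq_bigr do rewrite /= count_nseq Ms mu_prod_XsubC /=.
have rootE x : (x \in rootsR (char_poly M)) = (x \in s).
  have := roots_on_rootsR M0 x; rewrite in_itv /= => <-.
  by rewrite Ms root_prod_XsubC.
have [ys|ys] := boolP (y \in s); last first.
  rewrite (count_memPn ys) big1_seq// => x /andP[_].
  by rewrite rootE => xs; case: eqP => // xy; rewrite -xy xs in ys.
rewrite (bigD1_seq y) ?rootE//=; last exact: uniq_roots.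
by rewrite eqxx mul1n big1 ?addn0// => x /negbTE->.
Qed.

Definition scatter_eigenvalues {n d k} (W : 'M[R]_(n, d))
    (c : 'I_n -> 'I_k) : seq R :=
  eigenvalues (invmx (total_scatter W) *m between_scatter W c).

Definition distinctness {n d k} (W : 'M[R]_(n, d)) (c : 'I_n -> 'I_k) : R :=
  (k.-1)%:R^-1 * \sum_(j < k.-1) (scatter_eigenvalues W c)`_j.

Definition centered {n d} (W : 'M[R]_(n, d)) : 'M[R]_(n, d) :=
  \matrix_(i, j) (W i j - grand_mean W 0 j).

Definition isotropic {n d} (X : 'M[R]_(n, d)) (A : 'M[R]_d) (L : 'rV[R]_d) :
    'M[R]_(n, d) :=
  centered X *m A *m diag_mx (\row_j (Num.sqrt (L 0 j))^-1).

End Scatter.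

Section Weighting.
Context {R : realType}.
Implicit Types n d k : nat.

Definition weight {n d} (alpha : R) (Y : 'M[R]_(n, d)) (i : 'I_n) : R :=
  Num.sqrt (1 / (1 + 1 / alpha * enorm (row i Y) ^+ 2)).

Definition weighted_data {n d} (alpha : R) (Y : 'M[R]_(n, d)) :
    'M[R]_(n, d) :=
  \matrix_(i, j) (weight alpha Y i * Y i j).

Definition weight_shift {n d} (alpha : R) (Y : 'M[R]_(n, d)) : 'M[R]_n :=
  1 / (2 * alpha) *: diag_mx (\row_i enorm (row i Y) ^+ 2).

Definition membership {n k} (c : 'I_n -> 'I_k) : 'M[R]_(n, k) :=
  \matrix_(i, l) (c i == l)%:R.

Definition cluster_proj {n k} (c : 'I_n -> 'I_k) : 'M[R]_n :=
  let E := membership c in E *m invmx (E^T *m E) *m E^T.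

Definition delta_total {n d} (alpha : R) (Y : 'M[R]_(n, d)) : 'M[R]_d :=
  - 2 *: (Y^T *m weight_shift alpha Y *m Y).

Definition delta_between {n d k} (alpha : R) (Y : 'M[R]_(n, d))
    (c : 'I_n -> 'I_k) : 'M[R]_d :=
  - (Y^T *m cluster_proj c *m weight_shift alpha Y *m Y)
  - Y^T *m weight_shift alpha Y *m cluster_proj c *m Y.

(* First-order value of the j-th eigenvalue for the weighted data; [a j] is
   the eigenvector of [between_scatter Y c] for its j-th eigenvalue. *)
Definition linearized_eigenvalue {n d k} (alpha : R) (Y : 'M[R]_(n, d))
    (c : 'I_n -> 'I_k) (a : 'I_k.-1 -> 'cV[R]_d) (j : 'I_k.-1) : R :=
  let lam := (scatter_eigenvalues Y c)`_j in
  lam + ((a j)^T *m (delta_between alpha Y c - lam *: delta_total alpha Y)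
         *m a j) 0 0.

Definition linearized_distinctness {n d k} (alpha : R) (Y : 'M[R]_(n, d))
    (c : 'I_n -> 'I_k) (a : 'I_k.-1 -> 'cV[R]_d) : R :=
  (k.-1)%:R^-1 * \sum_(j < k.-1) linearized_eigenvalue alpha Y c a j.

(* The exact weights agree with I - Delta, and the exact scatter matrices of
   (I - Delta) Y with their linearizations, up to second-order terms. *)

Lemma sqrt_inv_linear_bound (s w : R) : 0 <= s -> 0 <= w ->
  w ^+ 2 * (1 + s) = 1 -> `|w - (1 - s / 2)| <= s ^+ 2.
Proof.
move=> s0 w0 w2; have s1 : 0 < 1 + s by lra.
have sq0 : 0 <= s ^+ 2 by exact: sqr_ge0.
have sq3 : 0 <= s ^+ 3 by exact: exprn_ge0.
have sq5 : 0 <= s ^+ 5 by exact: exprn_ge0.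
rewrite ler_distl; apply/andP; split.
- suff : 1 - s / 2 <= w by lra.
  have [s2|s2] := leP 2 s; first by lra.
  rewrite -(@ler_pXn2r _ 2)// ?nnegrE//; last by lra.
  rewrite -(ler_pM2r s1) w2 -subr_ge0.
  have -> : 1 - (1 - s / 2) ^+ 2 * (1 + s) = s ^+ 2 * (3 - s) / 4 by field.
  by rewrite divr_ge0// mulr_ge0//; lra.
- have r0 : 0 <= 1 - s / 2 + s ^+ 2.
    have -> : 1 - s / 2 + s ^+ 2 = (s - 1 / 4) ^+ 2 + 15 / 16 by field.
    have := sqr_ge0 (s - 1 / 4); lra.
  rewrite -(@ler_pXn2r _ 2)// ?nnegrE//.
  rewrite -(ler_pM2r s1) w2 -subr_ge0.
  have -> : (1 - s / 2 + s ^+ 2) ^+ 2 * (1 + s) - 1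
    = 5 / 4 * s ^+ 2 + 5 / 4 * s ^+ 3 + s ^+ 5 by field.
  lra.
Qed.

Lemma weight_linearized n d (alpha : R) (Y : 'M[R]_(n, d)) i : 0 < alpha ->
  `|weight alpha Y i - (1 - weight_shift alpha Y i i)|
  <= (enorm (row i Y) ^+ 2 / alpha) ^+ 2.
Proof.
move=> alpha0; rewrite /weight /weight_shift !mxE eqxx mulr1n.
set e := enorm _.
have -> : 1 / (2 * alpha) * e ^+ 2 = (e ^+ 2 / alpha) / 2.
  by field; rewrite gt_eqF.
have -> : 1 / alpha * e ^+ 2 = e ^+ 2 / alpha by rewrite mul1r mulrC.
set s := e ^+ 2 / alpha.
have s0 : 0 <= s by rewrite divr_ge0// ?sqr_ge0// ltW.
have s1 : 0 < 1 + s by lra.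
set w := Num.sqrt _.
have w0 : 0 <= w by exact: sqrtr_ge0.
have w2 : w ^+ 2 * (1 + s) = 1.
  rewrite sqr_sqrtr; last by rewrite divr_ge0// ltW.
  by rewrite mul1r mulVf// gt_eqF.
exact: sqrt_inv_linear_bound.
Qed.

Lemma tr_mulmx_rows n p q (U : 'M[R]_(n, p)) (V : 'M[R]_(n, q)) :
  U^T *m V = \sum_i (row i U)^T *m row i V.
Proof.
apply/matrixP => a b; rewrite summxE !mxE; apply: eq_bigr => i _.
by rewrite !mxE big_ord1 !mxE.
Qed.

Lemma tr_weight_shift n d (alpha : R) (Y : 'M[R]_(n, d)) :
  (weight_shift alpha Y)^T = weight_shift alpha Y.
Proof. by rewrite /weight_shift linearZ /= tr_diag_mx. Qed.

Lemma tr_mulmxBB p q (u v : 'M[R]_(p, q)) :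
  (u - v)^T *m (u - v) = u^T *m u - (u^T *m v + v^T *m u) + v^T *m v.
Proof.
rewrite [(u - v)^T]linearB /= mulmxBl !mulmxBr opprB opprD -!addrA.
by congr (_ + (_ + _)); rewrite addrC.
Qed.

Lemma grand_meanB n d (Y U : 'M[R]_(n, d)) :
  grand_mean (Y - U) = grand_mean Y - grand_mean U.
Proof.
rewrite /grand_mean -scalerBr -sumrB; congr (_ *: _).
by apply: eq_bigr => i _; rewrite linearB.
Qed.

Lemma cluster_meanB n d k (Y U : 'M[R]_(n, d)) (c : 'I_n -> 'I_k) l :
  cluster_mean (Y - U) c l = cluster_mean Y c l - cluster_mean U c l.
Proof.
rewrite /cluster_mean -scalerBr -sumrB; congr (_ *: _).
by apply: eq_bigr => i _; rewrite linearB.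
Qed.

Lemma total_scatter_linearized n d (alpha : R) (Y : 'M[R]_(n, d)) :
  grand_mean Y = 0 ->
  total_scatter ((1%:M - weight_shift alpha Y) *m Y)
  = total_scatter Y + delta_total alpha Y
    + total_scatter (weight_shift alpha Y *m Y).
Proof.
move=> Y0; set U := weight_shift alpha Y *m Y.
have sumY0 : \sum_i row i Y = 0.
  case: n Y Y0 @U => [|n] Y Y0 U; first by rewrite big_ord0.
  by move/eqP: Y0; rewrite scaler_eq0 invr_eq0 pnatr_eq0 => /eqP.
rewrite mulmxBl mul1mx -/U /total_scatter grand_meanB Y0 sub0r.
under eq_bigr => i _.
  have -> : row i (Y - U) - - grand_mean U
          = (row i Y - 0) - (row i U - grand_mean U).
    by rewrite linearB /= subr0 opprB opprK addrA addrAC.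
  rewrite tr_mulmxBB; over.
rewrite big_split sumrB /=; congr (_ + _); congr (_ + _).
rewrite big_split /=.
have cross : \sum_i (row i Y - 0)^T *m (row i U - grand_mean U) = Y^T *m U.
  rewrite tr_mulmx_rows; under eq_bigr do rewrite subr0 mulmxBr.
  rewrite sumrB -mulmx_suml -[X in _ - X *m _]raddf_sum /= sumY0.
  by rewrite trmx0 mul0mx subr0.
have cross' : \sum_i (row i U - grand_mean U)^T *m (row i Y - 0) = U^T *m Y.
  rewrite -[RHS]trmxK trmx_mul trmxK -cross raddf_sum /=; apply: eq_bigr => i _.
  by rewrite trmx_mul trmxK.
rewrite cross cross' /delta_total /U trmx_mul tr_weight_shift mulmxA.
by rewrite scaleNr scaler_nat mulr2n.
Qed.

Lemma membership_gram n k (c : 'I_n -> 'I_k) :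
  (membership c)^T *m membership c
  = diag_mx (\row_l #|cluster_of c l|%:R) :> 'M[R]_k.
Proof.
apply/matrixP => l l'; rewrite !mxE.
under eq_bigr do rewrite !mxE.
have [<-|ll'] := eqVneq l l'.
  rewrite mulr1n -sum1_card natr_sum [RHS]big_mkcond; apply: eq_bigr => i _.
  by rewrite inE; case: (c i == l); rewrite ?mulr1// mulr0.
rewrite mulr0n big1// => i _.
have [->|] := eqVneq (c i) l; first by rewrite (negbTE ll') mulr0.
by rewrite mul0r.
Qed.

Lemma row_membership n d k (c : 'I_n -> 'I_k) (W : 'M[R]_(n, d)) l :
  row l ((membership c)^T *m W) = \sum_(i in cluster_of c l) row i W.
Proof.
apply/rowP => j; rewrite !mxE summxE [in RHS]big_mkcond; apply: eq_bigr => i _.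
by rewrite !mxE inE; case: (c i == l); rewrite ?mul1r// mul0r.
Qed.

Lemma tr_cluster_proj_mul n d k (c : 'I_n -> 'I_k) (Y U : 'M[R]_(n, d)) :
  (forall l, (0 < #|cluster_of c l|)%N) ->
  Y^T *m cluster_proj c *m U
  = \sum_l #|cluster_of c l|%:R *:
      ((cluster_mean Y c l)^T *m cluster_mean U c l).
Proof.
move=> c0; set v : 'rV[R]_k := \row_l #|cluster_of c l|%:R.
have v0 l : v 0 l != 0 by rewrite mxE pnatr_eq0 -lt0n.
set v' : 'rV[R]_k := \row_l (v 0 l)^-1.
have vM : diag_mx v *m diag_mx v' = 1%:M.
  apply/matrixP => l l'; rewrite mul_diag_mx !mxE.
  have [_|ll'] := eqVneq l l'; last by rewrite mulr0n mulr0.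
  by move: (v0 l); rewrite mxE mulr1n => /mulfV.
have vV : invmx (diag_mx v) = diag_mx v'.
  have [vu _] := mulmx1_unit vM.
  by rewrite -[RHS](mulKmx vu) vM mulmx1.
rewrite /cluster_proj membership_gram -/v vV.
have -> : Y^T *m (membership c *m diag_mx v' *m (membership c)^T) *m U
  = ((membership c)^T *m Y)^T *m (diag_mx v' *m ((membership c)^T *m U)).
  by rewrite trmx_mul trmxK !mulmxA.
rewrite (tr_mulmx_rows (_ *m Y)); apply: eq_bigr => l _.
rewrite (row_mul _ (diag_mx v')) row_diag_mx -scalemxAl -rowE !row_membership /cluster_mean [v' 0 l]mxE.
have := v0 l; rewrite [v 0 l]mxE => nl0.
rewrite [(_ *: _)^T]linearZ /= -!scalemxAr -scalemxAl !scalerA.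
by rewrite mulrA mulfV// mul1r.
Qed.

Lemma between_scatter_linearized n d k (alpha : R) (Y : 'M[R]_(n, d))
    (c : 'I_n -> 'I_k) :
  grand_mean Y = 0 -> (forall l, (0 < #|cluster_of c l|)%N) ->
  between_scatter ((1%:M - weight_shift alpha Y) *m Y) c
  = between_scatter Y c + delta_between alpha Y c
    + between_scatter (weight_shift alpha Y *m Y) c.
Proof.
move=> Y0 c0; set U := weight_shift alpha Y *m Y.
have sumY0 : \sum_i row i Y = 0.
  case: n Y Y0 @U c c0 => [|n] Y Y0 U c c0; first by rewrite big_ord0.
  by move/eqP: Y0; rewrite scaler_eq0 invr_eq0 pnatr_eq0 => /eqP.
have sumc : \sum_l #|cluster_of c l|%:R *: cluster_mean Y c l = 0.
  rewrite -[RHS]sumY0 (partition_big c xpredT)//=; apply: eq_bigr => l _.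
  rewrite /cluster_mean scalerA mulfV ?pnatr_eq0 -?lt0n// scale1r.
  by apply: eq_bigl => i; rewrite inE.
rewrite mulmxBl mul1mx -/U /between_scatter grand_meanB Y0 sub0r.
under eq_bigr => l _.
  rewrite cluster_meanB.
  have -> : cluster_mean Y c l - cluster_mean U c l - - grand_mean U
          = (cluster_mean Y c l - 0) - (cluster_mean U c l - grand_mean U).
    by rewrite subr0 opprB opprK addrA addrAC.
  rewrite tr_mulmxBB scalerDr scalerBr; over.
rewrite big_split sumrB /=; congr (_ + _); congr (_ + _).
under eq_bigr do rewrite scalerDr.
rewrite big_split /=.
have cross : \sum_l #|cluster_of c l|%:R *: ((cluster_mean Y c l - 0)^T
    *m (cluster_mean U c l - grand_mean U)) = Y^T *m cluster_proj c *m U.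
  rewrite tr_cluster_proj_mul//.
  under eq_bigr do rewrite subr0 mulmxBr scalerBr.
  rewrite sumrB; under [X in _ - X]eq_bigr do rewrite scalemxAl -linearZ /=.
  by rewrite -mulmx_suml -[X in _ - X *m _]raddf_sum /= sumc trmx0 mul0mx subr0.
have trH : (cluster_proj c)^T = cluster_proj c :> 'M[R]_n.
  rewrite /cluster_proj !trmx_mul trmxK trmx_inv trmx_mul trmxK.
  by rewrite mulmxA.
have cross' : \sum_l #|cluster_of c l|%:R *: ((cluster_mean U c l - grand_mean U)^T
    *m (cluster_mean Y c l - 0)) = U^T *m cluster_proj c *m Y.
  have -> : U^T *m cluster_proj c *m Y = (Y^T *m cluster_proj c *m U)^T.
    by rewrite (trmx_mul _ U) (trmx_mul Y^T) trH trmxK mulmxA.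
  rewrite -cross raddf_sum /=; apply: eq_bigr => l _.
  by rewrite [RHS]linearZ /= [in RHS]trmx_mul trmxK.
rewrite cross cross' /delta_between /U trmx_mul tr_weight_shift !mulmxA.
by rewrite opprD.
Qed.

End Weighting.

Section GaussianMixture.
Context {R : realType}.

(* [normal_prob] is parametrised by the standard deviation and is not a point
   mass when it is 0. *)
Definition normal_law (m v : R) (A : set R) : \bar R :=
  if v == 0 then \d_m A else normal_prob m (Num.sqrt v) A.

Definition is_covariance {d} (S : 'M[R]_d) : Prop :=
  S^T = S /\ forall u : 'cV[R]_d, 0 <= (u^T *m S *m u) 0 0.

Context {disp : measure_display} {Omega : measurableType disp}.

Definition observation_events {n d k} (X : Omega -> 'M[R]_(n, d))
    (c : Omega -> 'I_n -> 'I_k) (i : 'I_n) : set (set Omega) :=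
  <<s [set F : set Omega |
        (exists (j : 'I_d) (A : set R),
           measurable A /\ F = [set w | A (X w i j)])
        \/ (exists l : 'I_k, F = [set w | c w i = l])] >>.

(* The labelled observations (row i X, c i) are independent and each satisfies
   P (c i = l, row i X \in B) = 1/k * N(m l, S l)(B); the Gaussian law N(m, S)
   is characterised by its one-dimensional marginals (Cramer-Wold): u.N(m, S)
   is the normal law with mean m.u and variance u^T S u, for every u. *)
Definition gaussian_mixture_sample {n d k} (P : probability Omega R)
    (X : Omega -> 'M[R]_(n, d)) (c : Omega -> 'I_n -> 'I_k)
    (m : 'I_k -> 'rV[R]_d) (S : 'I_k -> 'M[R]_d) : Prop :=
  [/\ forall l, is_covariance (S l),
      forall i j, measurable_fun setT (fun w => X w i j),
      forall i l, measurable [set w | c w i = l],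
      forall F : 'I_n -> set Omega,
        (forall i, observation_events X c i (F i)) ->
        P (\bigcap_i F i) = (\prod_i P (F i))%E
    & forall (i : 'I_n) (l : 'I_k) (u : 'cV[R]_d) (A : set R), measurable A ->
        P [set w | c w i = l /\ A ((row i (X w) *m u) 0 0)]
        = ((k%:R^-1)%:E *
           normal_law ((m l *m u) 0 0)%R ((u^T *m S l *m u) 0 0)%R A)%E].

End GaussianMixture.

(* Main.v *)
Require Import Defs.
From HB Require Import structures.
From mathcomp Require Import all_boot all_order all_algebra.
From mathcomp Require Import all_classical all_reals all_analysis.
From mathcomp Require Import ring lra.
Import Order.TTheory GRing.Theory Num.Theory.
Import numFieldNormedType.Exports.
Local Open Scope ring_scope.

(** For a unit eigenvector a of B_Y = Y^T H Y with eigenvalue lam, put u = Y a,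
    which is a unit vector since Y^T Y = I.  The first-order shift of lam is
    2 r^T Delta u with r = lam u - H u.  As H is an orthogonal projection and
    u^T H u = lam, r is orthogonal to u and |r|^2 = lam (1 - lam) <= 1.  By
    orthogonality Delta may be replaced by its deviation from its mean, so the
    bound on sd(|y_i|^2) and Cauchy-Schwarz give |shift| <= d / (alpha sqrt n).
    This holds for each eigenvalue separately, so the a_j need not be
    orthogonal.  Finally the averages for X and Y agree, because T_Y^-1 B_Y is
    similar to T_X^-1 B_X, and they are nonnegative. *)

(** Conjugation by the constant polynomial matrices [Q'] and [Q] carries ['X - A] to the
    characteristic matrix of the conjugate, and determinants multiply. *)
Lemma char_poly_conj (F : comUnitRingType) n (P A : 'M[F]_n) :
  P \in unitmx -> char_poly (invmx P *m A *m P) = char_poly A.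
Proof.
move=> Pu; pose Q := map_mx polyC P; pose Q' := map_mx polyC (invmx P).
have Q'Q : Q' *m Q = 1%:M by rewrite -map_mxM mulVmx// map_mx1.
have E : char_poly_mx (invmx P *m A *m P) = Q' *m char_poly_mx A *m Q.
  rewrite /char_poly_mx !map_mxM mulmxBr mulmxBl -scalemx1 -scalemxAr mulmx1.
  by rewrite -scalemxAl Q'Q scalemx1.
rewrite /char_poly E !det_mulmx mulrAC -det_mulmx Q'Q det1.
by rewrite mul1r.
Qed.

(** * Scatter matrices under linear maps and centering; the cluster projection *)

Section Scatter.
Context {R : realType} {n d k : nat}.
Implicit Types (W Y : 'M[R]_(n, d)) (P : 'M[R]_d) (c : 'I_n -> 'I_k).

Lemma grand_mean_mulmx W P : grand_mean (W *m P) = grand_mean W *m P.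
Proof.
rewrite /grand_mean -scalemxAl mulmx_suml; congr (_ *: _).
by apply: eq_bigr => i _; rewrite row_mul.
Qed.

Lemma cluster_mean_mulmx W P c l :
  cluster_mean (W *m P) c l = cluster_mean W c l *m P.
Proof.
rewrite /cluster_mean -scalemxAl mulmx_suml; congr (_ *: _).
by apply: eq_bigr => i _; rewrite row_mul.
Qed.

Lemma total_scatter_mulmx W P :
  total_scatter (W *m P) = P^T *m total_scatter W *m P.
Proof.
rewrite /total_scatter mulmx_sumr mulmx_suml; apply: eq_bigr => i _.
by rewrite grand_mean_mulmx row_mul -mulmxBl trmx_mul !mulmxA.
Qed.

Lemma between_scatter_mulmx W P c :
  between_scatter (W *m P) c = P^T *m between_scatter W c *m P.
Proof.
rewrite /between_scatter mulmx_sumr mulmx_suml; apply: eq_bigr => l _.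
rewrite grand_mean_mulmx cluster_mean_mulmx -mulmxBl trmx_mul.
by rewrite -scalemxAr -scalemxAl !mulmxA.
Qed.

Lemma row_centered W i : row i (centered W) = row i W - grand_mean W.
Proof. by apply/rowP => j; rewrite !mxE. Qed.

Lemma grand_mean_centered W : (0 < n)%N -> grand_mean (centered W) = 0.
Proof.
move=> n0; rewrite /grand_mean; under eq_bigr do rewrite row_centered.
rewrite sumrB sumr_const card_ord scalerBr -[X in _ - _ *: X]scaler_nat.
by rewrite scalerA mulVf ?pnatr_eq0 -?lt0n// scale1r subrr.
Qed.

Lemma cluster_mean_centered W c l : (0 < #|cluster_of c l|)%N ->
  cluster_mean (centered W) c l = cluster_mean W c l - grand_mean W.
Proof.
move=> n0; rewrite /cluster_mean; under eq_bigr do rewrite row_centered.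
rewrite sumrB sumr_const scalerBr -[X in _ - _ *: X]scaler_nat.
by rewrite scalerA mulVf ?pnatr_eq0 -?lt0n// scale1r.
Qed.

Lemma total_scatter_centered W : (0 < n)%N ->
  total_scatter (centered W) = total_scatter W.
Proof.
move=> n0; apply: eq_bigr => i _.
by rewrite grand_mean_centered// subr0 row_centered.
Qed.

Lemma between_scatter_centered W c :
  (0 < n)%N -> (forall l, (0 < #|cluster_of c l|)%N) ->
  between_scatter (centered W) c = between_scatter W c.
Proof.
move=> n0 c0; apply: eq_bigr => l _.
by rewrite grand_mean_centered// subr0 cluster_mean_centered.
Qed.

Lemma total_scatter_gram Y : grand_mean Y = 0 -> total_scatter Y = Y^T *m Y.
Proof.
by move=> Y0; rewrite tr_mulmx_rows; apply: eq_bigr => i _; rewrite Y0 subr0.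
Qed.

Lemma between_scatter_gram Y c :
  grand_mean Y = 0 -> (forall l, (0 < #|cluster_of c l|)%N) ->
  between_scatter Y c = Y^T *m cluster_proj c *m Y.
Proof.
move=> Y0 c0; rewrite tr_cluster_proj_mul//; apply: eq_bigr => l _.
by rewrite Y0 subr0.
Qed.

Lemma distinctness_centered W c :
  (0 < n)%N -> (forall l, (0 < #|cluster_of c l|)%N) ->
  distinctness (centered W) c = distinctness W c.
Proof.
move=> n0 c0; rewrite /distinctness /scatter_eigenvalues.
by rewrite (total_scatter_centered W n0) (between_scatter_centered W c n0 c0).
Qed.

(** Both scatter matrices undergo the same congruence by [P], so T^-1 B is only conjugated by [P]
    and keeps its characteristic polynomial. *)
Lemma distinctness_mulmx W P c :
  P \in unitmx -> total_scatter W \in unitmx ->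
  distinctness (W *m P) c = distinctness W c.
Proof.
move=> Pu Tu; rewrite /distinctness /scatter_eigenvalues /eigenvalues.
suff -> : invmx (total_scatter (W *m P)) *m between_scatter (W *m P) c
  = invmx P *m (invmx (total_scatter W) *m between_scatter W c) *m P.
  by rewrite (char_poly_conj _ _ _ _ Pu).
rewrite total_scatter_mulmx between_scatter_mulmx.
have PTu : P^T \in unitmx by rewrite unitmx_tr.
set T := total_scatter W in Tu *.
have Mu : P^T *m T *m P \in unitmx by rewrite !unitmx_mul PTu Tu.
(* Left multiplication by the invertible P^T T P is injective; it turns both sides into P^T B P. *)
apply: (can_inj (mulKmx Mu)).
by rewrite mulKVmx// !mulmxA mulmxK// mulmxK.
Qed.

Lemma tr_cluster_proj c : (cluster_proj c)^T = cluster_proj c :> 'M[R]_n.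
Proof.
rewrite /cluster_proj !trmx_mul trmxK trmx_inv trmx_mul trmxK.
by rewrite mulmxA.
Qed.

Lemma cluster_proj_idem c : (forall l, (0 < #|cluster_of c l|)%N) ->
  cluster_proj c *m cluster_proj c = cluster_proj c :> 'M[R]_n.
Proof.
move=> c0; rewrite /cluster_proj; set E := membership c.
(* The Gram matrix is the diagonal matrix of cluster sizes, all nonzero. *)
have Gu : E^T *m E \in @unitmx R k.
  rewrite membership_gram unitmxE det_diag unitfE prodf_seq_neq0.
  by apply/allP => l _ /=; rewrite mxE pnatr_eq0 -lt0n.
by rewrite !mulmxA -[X in X *m _ *m E^T]mulmxA mulmxKV.
Qed.

End Scatter.

(** * Cauchy-Schwarz and sums of squares *)

Lemma sum_mul_le_norm (R : realFieldType) (I : finType) (C : R) (v x : I -> R) :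
  0 < C -> \sum_i v i ^+ 2 <= C ^+ 2 -> \sum_i x i ^+ 2 <= 1 ->
  `|\sum_i v i * x i| <= C.
Proof.
move=> C0 hv hx; apply: le_trans (ler_norm_sum _ _ _) _.
rewrite -(ler_pM2l C0) -expr2 mulr_sumr.
(* Expand (|v_i| - C |x_i|)^2 >= 0; summed over i, the right-hand sides add up to at most C^2. *)
have h i : C * `|v i * x i| <= (v i ^+ 2 + C ^+ 2 * x i ^+ 2) / 2.
  rewrite normrM -(real_normK (num_real (v i))) -(real_normK (num_real (x i))).
  by have := sqr_ge0 (`|v i| - C * `|x i|); nra.
apply: le_trans (ler_sum _ (fun i _ => h i)) _.
rewrite -mulr_suml big_split /= -mulr_sumr.
have C2 : 0 <= C ^+ 2 by exact: sqr_ge0.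
nra.
Qed.

Lemma enorm_sqr (R : realType) d (v : 'rV[R]_d) :
  enorm v ^+ 2 = \sum_j v 0 j ^+ 2.
Proof. by rewrite sqr_sqrtr// sumr_ge0// => j _; exact: sqr_ge0. Qed.

Lemma sum_enorm_sqr_row (R : realType) n d (Y : 'M[R]_(n, d)) :
  \sum_i enorm (row i Y) ^+ 2 = \tr (Y^T *m Y).
Proof.
under eq_bigr do rewrite enorm_sqr.
rewrite exchange_big /mxtrace; apply: eq_bigr => j _; rewrite mxE.
by apply: eq_bigr => i _; rewrite !mxE expr2.
Qed.

Lemma sum_dev_sqr (R : realType) n (f : 'I_n -> R) : (0 < n)%N ->
  \sum_i (f i - emp_mean f) ^+ 2 = n%:R * emp_sd f ^+ 2.
Proof.
move=> n0; rewrite sqr_sqrtr; first by rewrite mulVKf// pnatr_eq0 -lt0n.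
by rewrite mulr_ge0 ?invr_ge0// sumr_ge0// => i _; exact: sqr_ge0.
Qed.

Lemma tr_mul_col (R : pzSemiRingType) n (x y : 'cV[R]_n) :
  (x^T *m y) 0 0 = \sum_i x i 0 * y i 0.
Proof. by rewrite mxE; apply: eq_bigr => i _; rewrite mxE. Qed.

(** * The isotropic transformation as a whitening matrix *)

Section Isotropic.
Context {R : realType} {n d : nat}.
Implicit Types (X : 'M[R]_(n, d)) (A : 'M[R]_d) (L : 'rV[R]_d).

Definition isotropic_mx A L : 'M[R]_d :=
  A *m diag_mx (\row_j (Num.sqrt (L 0 j))^-1).

Lemma isotropicE X A L : isotropic X A L = centered X *m isotropic_mx A L.
Proof. by rewrite /isotropic mulmxA. Qed.

Lemma isotropic_mx_whitens A L : A^T *m A = 1%:M -> (forall j, 0 < L 0 j) ->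
  (isotropic_mx A L)^T *m (A *m diag_mx L *m A^T) *m isotropic_mx A L = 1%:M.
Proof.
move=> AA L0; rewrite /isotropic_mx trmx_mul tr_diag_mx !mulmxA.
rewrite -[X in X *m _ *m A^T]mulmxA AA mulmx1.
rewrite -[X in X *m diag_mx _ = _]mulmxA AA mulmx1.
rewrite !mulmx_diag -diag_const_mx; congr diag_mx.
apply/rowP => j; rewrite !mxE.
rewrite mulrAC -invfM -expr2 sqr_sqrtr ?ltW// mulVf//.
by rewrite gt_eqF.
Qed.

End Isotropic.

(** * The residual [r] of a unit vector under an orthogonal projection *)

Section ProjectionResidual.
Context {R : realFieldType} {n : nat} (H : 'M[R]_n) (u : 'cV[R]_n) (lam : R).
Context (HT : H^T = H) (HH : H *m H = H).
Context (uu : u^T *m u = 1%:M) (uHu : u^T *m H *m u = lam%:M).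

Let r := lam *: u - H *m u.

Let rT : r^T = lam *: u^T - u^T *m H.
Proof.
rewrite -[X in _ - _ *m X]HT -trmx_mul.
by apply/matrixP => i j; rewrite !mxE.
Qed.

Let rTu : r^T *m u = 0.
Proof. by rewrite rT mulmxBl -scalemxAl uu uHu scalemx1 subrr. Qed.

(** Since [H] is symmetric and idempotent, [lam] is the squared norm of [H *m u]. *)
Lemma proj_quadratic_ge0 : 0 <= lam.
Proof.
have : ((H *m u)^T *m (H *m u)) 0 0 = lam.
  rewrite trmx_mul HT mulmxA -[X in X *m u]mulmxA HH uHu.
  by rewrite mxE eqxx mulr1n.
by rewrite tr_mul_col => <-; apply: sumr_ge0 => i _; rewrite -expr2 sqr_ge0.
Qed.

Lemma proj_residual_orthogonal : \sum_i r i 0 * u i 0 = 0.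
Proof. by rewrite -tr_mul_col rTu mxE. Qed.

Lemma proj_residual_sqr : \sum_i r i 0 ^+ 2 = lam * (1 - lam).
Proof.
transitivity ((r^T *m r) 0 0).
  by rewrite tr_mul_col; apply: eq_bigr => i _; rewrite expr2.
have -> : r^T *m r = (lam * (1 - lam))%:M.
  (* The component [lam *: u] of the second factor drops out by orthogonality; idempotence of [H]
     evaluates the remaining -r^T H u as lam - lam^2. *)
  rewrite {2}/r mulmxBr -scalemxAr rTu scaler0 sub0r rT mulmxBl.
  rewrite -scalemxAl !mulmxA uHu -[X in _ - X *m u]mulmxA HH uHu.
  by rewrite scale_scalar_mx -raddfB -raddfN /= opprB mulrBr mulr1.
by rewrite mxE eqxx mulr1n.
Qed.

(** Each u_i^2 is at most |u|^2 = 1, so the sum is at most |r|^2. The products r_i u_i are the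
    weights against which the deviations of |y_i|^2 are later tested. *)
Lemma proj_residual_mul_sqr_le1 : \sum_i (r i 0 * u i 0) ^+ 2 <= 1.
Proof.
have sum_uu : \sum_i u i 0 ^+ 2 = 1.
  transitivity ((u^T *m u) 0 0); last by rewrite uu mxE eqxx.
  by rewrite tr_mul_col; apply: eq_bigr => i _; rewrite expr2.
apply: (@le_trans _ _ (\sum_i r i 0 ^+ 2)); last first.
  (* lam (1 - lam) = 1/4 - (lam - 1/2)^2. *)
  by rewrite proj_residual_sqr; have := sqr_ge0 (lam - 1 / 2); nra.
apply: ler_sum => i _; rewrite exprMn ler_piMr ?sqr_ge0//.
rewrite -sum_uu (bigD1 i)//= lerDl.
by apply: sumr_ge0 => j _; exact: sqr_ge0.
Qed.

(** The left side is the first-order eigenvalue shift with Delta stripped of its factor 1/(2 alpha).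
    Its two mixed terms are transposes of each other, hence equal scalars, and the whole collapses
    to 2 r^T D u. *)
Lemma proj_residual_diag (s : 'rV[R]_n) : let D := diag_mx s in
  (- (u^T *m H *m D *m u) - u^T *m D *m H *m u
   + (2 * lam) *: (u^T *m D *m u)) 0 0
  = 2 * \sum_i s 0 i * (r i 0 * u i 0).
Proof.
move=> D; have rDu : (r^T *m D *m u) 0 0 = \sum_i s 0 i * (r i 0 * u i 0).
  rewrite -mulmxA tr_mul_col; apply: eq_bigr => i _.
  by rewrite mul_diag_mx !mxE mulrCA.
have pq : (u^T *m D *m H *m u) 0 0 = (u^T *m H *m D *m u) 0 0.
  have -> : u^T *m D *m H *m u = (u^T *m H *m D *m u)^T.
    by rewrite !trmx_mul trmxK HT tr_diag_mx !mulmxA.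
  by rewrite mxE.
rewrite -rDu rT !mulmxBl -!scalemxAl.
rewrite mxE [X in X + _]mxE [X in X + _ + _]mxE [X in _ + X + _]mxE.
rewrite [X in _ + X]mxE [X in _ = _ * X]mxE [X in _ = _ * (X + _)]mxE.
rewrite [X in _ = _ * (_ + X)]mxE pq.
ring.
Qed.

End ProjectionResidual.

(** The centre [mu] is arbitrary because [r] is orthogonal to [u]; [C] bounds the Euclidean norm of
    the deviations from it. The sign of [lam] is recorded for the final comparison. *)
Lemma eigenvalue_shift_bound (R : realType) n d k (alpha C mu : R)
    (Y : 'M[R]_(n, d)) (c : 'I_n -> 'I_k) (a : 'cV[R]_d) (lam : R) :
  grand_mean Y = 0 -> Y^T *m Y = 1%:M ->
  (forall l, (0 < #|cluster_of c l|)%N) ->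
  enorm a^T = 1 -> between_scatter Y c *m a = lam *: a ->
  0 < alpha -> 0 < C -> \sum_i (enorm (row i Y) ^+ 2 - mu) ^+ 2 <= C ^+ 2 ->
  0 <= lam /\
  `|(a^T *m (delta_between alpha Y c - lam *: delta_total alpha Y) *m a) 0 0|
    <= C / alpha.
Proof.
move=> Y0 YY c0 a1 aE alpha0 C0 hC.
pose H : 'M[R]_n := cluster_proj c; pose u := Y *m a.
have HT : H^T = H by exact: tr_cluster_proj.
have HH : H *m H = H by exact: cluster_proj_idem.
have uT : u^T = a^T *m Y^T by rewrite trmx_mul.
have uu : u^T *m u = 1%:M.
  rewrite uT mulmxA -[X in X *m a]mulmxA YY mulmx1.
  apply/matrixP => i j; rewrite !ord1 tr_mul_col mxE eqxx mulr1n.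
  have := enorm_sqr _ _ a^T; rewrite a1 expr1n => ->.
  by apply: eq_bigr => l _; rewrite mxE expr2.
have uHu : u^T *m H *m u = lam%:M.
  have -> : u^T *m H *m u = a^T *m (between_scatter Y c *m a).
    by rewrite (between_scatter_gram Y c Y0 c0) uT !mulmxA.
  rewrite aE -scalemxAr -[a^T]mulmx1 -YY mulmxA -uT -mulmxA.
  by rewrite -/u uu scalemx1.
split; first exact: proj_quadratic_ge0 HT HH uHu.
set s : 'rV[R]_n := \row_i enorm (row i Y) ^+ 2.
have -> : a^T *m (delta_between alpha Y c - lam *: delta_total alpha Y) *m a
  = (2 * alpha)^-1 *: (- (u^T *m H *m diag_mx s *m u)
      - u^T *m diag_mx s *m H *m u + (2 * lam) *: (u^T *m diag_mx s *m u)).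
  rewrite /delta_between /delta_total /weight_shift -/H -/s div1r uT /u.
  rewrite !(mulmxBr, mulmxBl, mulmxDr, mulmxDl, mulmxN, mulNmx).
  rewrite -!(scalemxAr, scalemxAl) !mulmxA.
  rewrite scalerDr scalerBr scalerN !scalerA.
  congr (_ + _); rewrite -scaleNr; congr (_ *: _).
  by field; rewrite gt_eqF.
rewrite mxE (proj_residual_diag _ _ _ HT).
set r := lam *: u - H *m u.
under eq_bigr do rewrite mxE.
have ru : \sum_i r i 0 * u i 0 = 0 by exact: proj_residual_orthogonal.
have -> : \sum_i enorm (row i Y) ^+ 2 * (r i 0 * u i 0)
  = \sum_i (enorm (row i Y) ^+ 2 - mu) * (r i 0 * u i 0).
  under [RHS]eq_bigr do rewrite mulrBl.
  by rewrite sumrB -mulr_sumr ru mulr0 subr0.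
have -> (x : R) : (2 * alpha)^-1 * (2 * x) = x / alpha by field; rewrite gt_eqF.
rewrite normrM (gtr0_norm (x := alpha^-1)) ?invr_gt0// ler_pM2r ?invr_gt0//.
apply: sum_mul_le_norm => //.
exact: proj_residual_mul_sqr_le1 HT HH uu uHu.
Qed.

(** * Averaging the shifts and comparing with the stated bound *)

Theorem proposition3p9 (R : realType) (n d k : nat)
  (hk : (2 <= k)%N) (hdk : (k - 1 < d)%N) (hdn : (d < n)%N)
  (* the random data set, with its latent cluster labels *)
  (disp : measure_display) (Omega : measurableType disp)
  (P : probability Omega R)
  (Xs : Omega -> 'M[R]_(n, d)) (cs : Omega -> 'I_n -> 'I_k)
  (m : 'I_k -> 'rV[R]_d) (Sigma : 'I_k -> 'M[R]_d)
  (hmix : gaussian_mixture_sample P Xs cs m Sigma)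
  (* the observed data set and cluster assignment *)
  (w : Omega) (X : 'M[R]_(n, d)) (hX : X = Xs w)
  (c : 'I_n -> 'I_k) (hc : c = cs w)
  (hbal : forall l : 'I_k, (#|cluster_of c l| * k)%N = n)
  (hrank : \rank (emp_cov X) = d)
  (* isotropic transformation *)
  (A : 'M[R]_d) (L : 'rV[R]_d)
  (hA : A^T *m A = 1%:M) (hL : forall j, 0 < L 0 j)
  (hspec : total_scatter X = A *m diag_mx L *m A^T)
  (Y : 'M[R]_(n, d)) (hY : Y = isotropic X A L)
  (alpha : R) (halpha : 0 < alpha)
  (hsd : emp_sd (fun i => enorm (row i Y) ^+ 2) < d%:R / n%:R)
  (* unit eigenvectors of B_Y for its k - 1 largest eigenvalues *)
  (a : 'I_k.-1 -> 'cV[R]_d)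
  (ha1 : forall j, enorm (a j)^T = 1)
  (ha : forall j, between_scatter Y c *m a j
                  = (scatter_eigenvalues Y c)`_j *: a j) :
  `| linearized_distinctness alpha Y c a - distinctness X c |
    <= 1 / Num.sqrt n%:R
       * (d%:R / alpha * (distinctness X c + Num.sqrt k%:R)).
Proof.
have n0 : (0 < n)%N by exact: leq_ltn_trans hdn.
have c0 l : (0 < #|cluster_of c l|)%N.
  by move: (hbal l); case: #|_| => // n_eq0; rewrite -n_eq0 in n0.
have d0 : (0 < d)%N by exact: leq_ltn_trans hdk.
have nR0 : 0 < n%:R :> R by rewrite ltr0n.
have Tc : total_scatter (centered X) = A *m diag_mx L *m A^T.
  by rewrite -hspec; exact: total_scatter_centered.
have TP := isotropic_mx_whitens A L hA hL; rewrite -Tc in TP.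
set Q := isotropic_mx A L in TP.
have YE : Y = centered X *m Q by rewrite hY isotropicE.
(* The whitening identity Q^T T Q = I exhibits inverses for [Q] and Q^T T, hence T is invertible
   too. *)
have [TuQ Qu] := mulmx1_unit TP.
have Tu : total_scatter (centered X) \in unitmx.
  by move: TuQ; rewrite unitmx_mul => /andP[].
have Y0 : grand_mean Y = 0.
  by rewrite YE grand_mean_mulmx (grand_mean_centered X n0) mul0mx.
have YY : Y^T *m Y = 1%:M.
  by rewrite -(total_scatter_gram Y Y0) YE total_scatter_mulmx.
have lamXY : distinctness X c = distinctness Y c.
  rewrite YE (distinctness_mulmx _ _ c Qu Tu).
  by rewrite (distinctness_centered X c n0 c0).
set s := fun i => enorm (row i Y) ^+ 2.
(* The squared deviations sum to n sd^2, which is below n (d/n)^2 = C^2. *)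
pose C : R := d%:R / Num.sqrt n%:R.
have C0 : 0 < C by rewrite divr_gt0 ?sqrtr_gt0 ?ltr0n.
have hC : \sum_i (enorm (row i Y) ^+ 2 - emp_mean s) ^+ 2 <= C ^+ 2.
  rewrite (sum_dev_sqr _ _ s n0).
  have -> : C ^+ 2 = n%:R * (d%:R / n%:R) ^+ 2.
    rewrite /C expr_div_n (sqr_sqrtr (ltW nR0)).
    by field; rewrite gt_eqF.
  rewrite (ler_pM2l nR0) ler_pXn2r; first exact: ltW hsd.
  - by [].
  - by rewrite nnegrE sqrtr_ge0.
  - by rewrite nnegrE divr_ge0.
have shift j := eigenvalue_shift_bound _ _ _ _ _ _ _ _ _ _ _
  Y0 YY c0 (ha1 j) (ha j) halpha C0 hC.
have K0 : 0 < (k.-1)%:R :> R by rewrite ltr0n -subn1 subn_gt0.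
have Ki0 : 0 <= (k.-1)%:R^-1 :> R by rewrite invr_ge0 (ltW K0).
have lam0 : 0 <= distinctness X c.
  rewrite lamXY; apply: (mulr_ge0 Ki0).
  by apply: sumr_ge0 => j _; exact: (shift j).1.
have Ca0 : 0 < C / alpha by exact: divr_gt0.
(* With [distinctness X c] rewritten for [Y], the unperturbed eigenvalues cancel termwise and leave
   an average of k - 1 shifts, each at most [C / alpha]. *)
apply: (@le_trans _ _ (C / alpha)).
  rewrite lamXY /linearized_distinctness /distinctness -mulrBr -sumrB normrM.
  rewrite (ger0_norm Ki0) (ler_pdivrMl _ _ K0).
  apply: le_trans (ler_norm_sum _ _ _) _.
  rewrite mulr_natl -[X in _ *+ X]card_ord -sumr_const; apply: ler_sum => j _.
  by rewrite /linearized_eigenvalue addrAC subrr add0r (shift j).2.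
have -> : 1 / Num.sqrt n%:R * (d%:R / alpha * (distinctness X c + Num.sqrt k%:R))
  = C / alpha * (distinctness X c + Num.sqrt k%:R).
  by rewrite /C; field; rewrite !gt_eqF ?sqrtr_gt0.
(* The extra factor is at least 1, since the averaged eigenvalue is nonnegative and sqrt k >= 1. *)
apply: (ler_peMr (ltW Ca0)).
rewrite -[leLHS]add0r; apply: lerD; first exact: lam0.
rewrite -[leLHS]sqrtr1; apply: ler_wsqrtr; rewrite ler1n.
exact: ltnW hk.
Qed.
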